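(* Let $A,B\in\mathbb{C}^{m\times n}$. The following statements are equivalent: (a) $A\leq^\diamond B$. (b) For every $W\in\mathbb{C}^{m\times n}$, $$A^\dagger = A^\dagger B A^\dagger + A^\dagger W A^\dagger - A^\dagger B B^\dagger W B^\dagger B A^\dagger.$$
   Context: $A^*$ is the conjugate transpose, $\mathcal{R}(\cdot)$ the range (column space), and $A^\dagger\in\mathbb{C}^{n\times m}$ the Moore-Penrose inverse of $A\in\mathbb{C}^{m\times n}$. The diamond partial order on $\mathbb{C}^{m\times n}$ is defined by: $A\leq^\diamond B$ iff $\mathcal{R}(A)\subseteq\mathcal{R}(B)$, $\mathcal{R}(A^* )\subseteq\mathcal{R}(B^* )$ and $AB^*A=AA^*A$. *)

(* Defs.v *)
From mathcomp Require Import all_boot all_order all_algebra.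
From mathcomp Require Import boolp classical_sets.

Set Implicit Arguments.
Unset Strict Implicit.
Unset Printing Implicit Defensive.

Import Order.TTheory GRing.Theory Num.Theory.
Local Open Scope ring_scope.
Local Open Scope sesquilinear_scope.
Local Open Scope classical_set_scope.

(* [A ^t*] is the conjugate transpose of [A] (see spectral.v). *)

Section MoorePenrose.
Variable C : numClosedFieldType.

Definition penrose m n (A : 'M[C]_(m, n)) (X : 'M[C]_(n, m)) : bool :=
  [&& A *m X *m A == A, X *m A *m X == X,
      (A *m X) ^t* == A *m X & (X *m A) ^t* == X *m A].

Lemma adjmxM m n p (A : 'M[C]_(m, n)) (B : 'M[C]_(n, p)) :
  (A *m B) ^t* = B ^t* *m A ^t*.
Proof. by rewrite trmx_mul map_mxM. Qed.

Lemma gram_unit m n (A : 'M[C]_(m, n)) :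
  row_free A -> A *m A ^t* \in unitmx.
Proof.
move=> Afree; rewrite -row_free_unit; apply: inj_row_free => v vAA0.
apply/eqP; rewrite -(mulmx_free_eq0 _ Afree); apply/eqP/rowP => k.
have : ((v *m A) *m (v *m A) ^t*) 0 0 = 0.
  by rewrite adjmxM mulmxA -(mulmxA v) vAA0 mul0mx mxE.
rewrite mxE => /eqP; rewrite psumr_eq0 => [/allP/(_ k)|i _].
  rewrite mem_index_enum 2![in X in _ -> X]mxE => /(_ isT).
  by rewrite !mxE mul_conjC_eq0 => /eqP.
by rewrite [_ i 0]mxE [_ i 0]mxE mul_conjC_ge0.
Qed.

Lemma penrose_exists m n (A : 'M[C]_(m, n)) : exists X, penrose A X.
Proof.
have [r [F [G [AE Ff Gf]]]] : exists r (F : 'M[C]_(m, r)) (G : 'M[C]_(r, n)),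
    [/\ A = F *m G, row_full F & row_free G].
  exists (\rank A), (col_base A), (row_base A).
  by rewrite mulmx_base col_base_full row_base_free.
have Gu : G *m G ^t* \in unitmx by apply: gram_unit.
have Fu : F ^t* *m F \in unitmx.
  rewrite -{2}(trmxCK F); apply: gram_unit.
  by rewrite /row_free mxrank_map mxrank_tr.
set P := invmx (G *m G ^t*); set Q := invmx (F ^t* *m F).
have PE : P ^t* = P by rewrite trmx_inv map_invmx adjmxM trmxCK.
have QE : Q ^t* = Q by rewrite trmx_inv map_invmx adjmxM trmxCK.
pose X := G ^t* *m P *m Q *m F ^t*.
have AX : A *m X = F *m Q *m F ^t*.
  by rewrite AE /X !mulmxA -(mulmxA F G) mulmxK.
have XA : X *m A = G ^t* *m P *m G.
  by rewrite AE /X !mulmxA -(mulmxA _ (F ^t*) F) mulmxKV.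
exists X; rewrite /penrose AX XA !adjmxM !trmxCK PE QE !mulmxA !eqxx !andbT.
rewrite AE !mulmxA -(mulmxA _ (F ^t*) F) mulmxKV // eqxx /=.
by rewrite /X -(mulmxA _ G) mulmxKV.
Qed.

Lemma penrose_uniq m n (A : 'M[C]_(m, n)) X Y :
  penrose A X -> penrose A Y -> X = Y.
Proof.
case/and4P=> /eqP X1 /eqP X2 /eqP X3 /eqP X4.
case/and4P=> /eqP Y1 /eqP Y2 /eqP Y3 /eqP Y4.
have AXY : A *m X = A *m Y.
  by rewrite -X3 -{1}Y1 -(mulmxA (A *m Y)) adjmxM X3 Y3 mulmxA X1.
have XAY : X *m A = Y *m A.
  by rewrite -X4 -{1}Y1 -(mulmxA A) mulmxA adjmxM X4 Y4 -mulmxA (mulmxA A) X1.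
by rewrite -X2 XAY -mulmxA AXY mulmxA Y2.
Qed.

Definition mpinv m n (A : 'M[C]_(m, n)) : 'M[C]_(n, m) :=
  xchoose (penrose_exists A).

Lemma mpinvP m n (A : 'M[C]_(m, n)) : penrose A (mpinv A).
Proof. exact: xchooseP. Qed.

Definition colspace m n (A : 'M[C]_(m, n)) : set 'cV[C]_m :=
  range (fun x : 'cV[C]_n => A *m x).

Lemma colspace_subP m n p (A : 'M[C]_(m, n)) (B : 'M[C]_(m, p)) :
  colspace A `<=` colspace B <-> (A^T <= B^T)%MS.
Proof.
split=> [AB|/submxP[D AD] _ [x _ <-]]; last first.
  by exists (D^T *m x) => //; rewrite mulmxA -[A]trmxK AD trmx_mul trmxK.
apply/row_subP => j; have [|y _ By] := AB (A *m (delta_mx j 0)).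
  by exists (delta_mx j 0).
by rewrite -tr_col colE -By trmx_mul submxMl.
Qed.

Definition diamond_le m n (A B : 'M[C]_(m, n)) : Prop :=
  [/\ colspace A `<=` colspace B,
      colspace (A ^t*) `<=` colspace (B ^t*) &
      A *m B ^t* *m A = A *m A ^t* *m A].

End MoorePenrose.

(* Main.v *)
Require Import Defs.
From mathcomp Require Import all_boot all_order all_algebra.
From mathcomp Require Import boolp classical_sets.
From mathcomp Require Import reals complex.
Local Open Scope ring_scope.

(** Write X = A^+, Y = B^+. The two range inclusions say that B Y A = A and
    A Y B = A, equivalently X B Y = X and Y B X = X, while A B^* A = A A^* A is
    equivalent to X B X = X. This gives (b). Conversely W = 0 in (b) gives
    X B X = X, so that X W X = X B Y W Y B X for all W. Replacing W by B Y W shows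
    that M = X - X B Y satisfies M W X = 0, hence M W M = 0, for all W, and
    W = M^+ gives M = 0; the proof of Y B X = X is symmetric. *)

Import GRing.Theory Num.Theory.
Local Open Scope sesquilinear_scope.
Local Open Scope classical_set_scope.

Section Diamond.
Variable C : numClosedFieldType.

Lemma mulmx_mpinvK {m n} (A : 'M[C]_(m, n)) : A *m mpinv A *m A = A.
Proof. by case/and4P: (mpinvP A) => /eqP. Qed.

Lemma mpinv_mulmxK {m n} (A : 'M[C]_(m, n)) : mpinv A *m A *m mpinv A = mpinv A.
Proof. by case/and4P: (mpinvP A) => _ /eqP. Qed.

Lemma adjmx_mul_mpinv {m n} (A : 'M[C]_(m, n)) :
  (A *m mpinv A) ^t* = A *m mpinv A.
Proof. by case/and4P: (mpinvP A) => _ _ /eqP. Qed.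

Lemma adjmx_mpinv_mul {m n} (A : 'M[C]_(m, n)) :
  (mpinv A *m A) ^t* = mpinv A *m A.
Proof. by case/and4P: (mpinvP A) => _ _ _ /eqP. Qed.

(** [B *m mpinv B] is the orthogonal projector onto the column space of [B]. *)
Lemma colspace_sub_mpinvP {m n p} (A : 'M[C]_(m, n)) (B : 'M[C]_(m, p)) :
  colspace A `<=` colspace B <-> B *m mpinv B *m A = A.
Proof.
rewrite colspace_subP; split=> [/submxP[D /(congr1 trmx)]|AE].
  by rewrite trmx_mul !trmxK => ->; rewrite mulmxA mulmx_mpinvK.
by rewrite -AE -mulmxA trmx_mul submxMl.
Qed.

Lemma colspace_adj_sub_mpinvP {m n p} (A : 'M[C]_(m, n)) (B : 'M[C]_(p, n)) :
  colspace (A ^t*) `<=` colspace (B ^t*) <-> A *m (mpinv B *m B) = A.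
Proof.
rewrite colspace_subP; split=> [/submxP[D]|AE].
  (* Transposing [A ^t*] leaves the entrywise conjugate of [A]; a second conjugation turns the
     inclusion into a factorisation of [A] with right factor [B]. *)
  rewrite -!map_trmx !trmxK => /(congr1 (map_mx Num.conj)).
  rewrite map_mxM -!map_mx_comp !(map_mx_id conjCK) => ->.
  by rewrite -mulmxA (mulmxA B) mulmx_mpinvK.
rewrite -AE mulmxA -!map_trmx !trmxK map_mxM; exact: submxMl.
Qed.

(** Since [P] and [A *m mpinv A] are both Hermitian, [P] fixes this projector from the left iff it
    does so from the right, by taking adjoints. *)
Lemma mpinv_mul_hermitian {m n} (A : 'M[C]_(m, n)) (P : 'M[C]_m) :
  P ^t* = P -> P *m A = A <-> mpinv A *m P = mpinv A.
Proof.
move=> PE; split=> [PA|XP].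
  have AXP : A *m mpinv A *m P = A *m mpinv A.
    by rewrite -{1}adjmx_mul_mpinv -{1}PE -adjmxM mulmxA PA adjmx_mul_mpinv.
  by rewrite -{1}mpinv_mulmxK -!mulmxA (mulmxA A) AXP mulmxA mpinv_mulmxK.
have PAX : P *m (A *m mpinv A) = A *m mpinv A.
  by rewrite -{1}adjmx_mul_mpinv -{1}PE -adjmxM -mulmxA XP adjmx_mul_mpinv.
by rewrite -{1}(mulmx_mpinvK A) mulmxA PAX mulmx_mpinvK.
Qed.

Lemma hermitian_mul_mpinv {m n} (A : 'M[C]_(m, n)) (Q : 'M[C]_n) :
  Q ^t* = Q -> A *m Q = A <-> Q *m mpinv A = mpinv A.
Proof.
move=> QE; split=> [AQ|QX].
  have QXA : Q *m (mpinv A *m A) = mpinv A *m A.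
    by rewrite -{1}adjmx_mpinv_mul -{1}QE -adjmxM -mulmxA AQ adjmx_mpinv_mul.
  by rewrite -{1}mpinv_mulmxK mulmxA QXA mpinv_mulmxK.
have XAQ : mpinv A *m A *m Q = mpinv A *m A.
  by rewrite -{1}adjmx_mpinv_mul -{1}QE -adjmxM mulmxA QX adjmx_mpinv_mul.
by rewrite -{1}(mulmx_mpinvK A) -!mulmxA (mulmxA (mpinv A)) XAQ mulmxA mulmx_mpinvK.
Qed.

(** Each side is the adjoint of the other up to factors that can be cancelled: [X *m X ^t*] and
    [X ^t* *m X] in one direction, [A *m A ^t*] and [A ^t* *m A] in the other. *)
Lemma diamond_eq_mpinvP {m n} (A B : 'M[C]_(m, n)) :
  A *m B ^t* *m A = A *m A ^t* *m A <-> mpinv A *m B *m mpinv A = mpinv A.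
Proof.
set X := mpinv A.
have AAX : A *m A ^t* *m X ^t* = A.
  by rewrite -mulmxA -adjmxM adjmx_mpinv_mul mulmxA mulmx_mpinvK.
have XAA : X ^t* *m A ^t* *m A = A.
  by rewrite -adjmxM adjmx_mul_mpinv mulmx_mpinvK.
have XXA : X *m X ^t* *m A ^t* = X.
  by rewrite -mulmxA -adjmxM adjmx_mul_mpinv mulmxA mpinv_mulmxK.
have AXX : A ^t* *m X ^t* *m X = X.
  by rewrite -adjmxM adjmx_mpinv_mul mpinv_mulmxK.
split=> [/(congr1 (fun M => M ^t*))|XBX].
  rewrite !adjmxM !trmxCK => E.
  transitivity (X *m X ^t* *m (A ^t* *m (B *m A ^t*)) *m (X ^t* *m X)).
    by rewrite !mulmxA XXA -!mulmxA (mulmxA (A ^t*)) AXX.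
  rewrite E !mulmxA XXA -!mulmxA (mulmxA (A ^t*)) AXX mulmxA.
  exact: mpinv_mulmxK.
transitivity (A *m A ^t* *m (X ^t* *m (B ^t* *m X ^t*)) *m (A ^t* *m A)).
  by rewrite !mulmxA AAX -!mulmxA (mulmxA (X ^t*)) XAA.
by rewrite -!adjmxM XBX !mulmxA AAX.
Qed.

Lemma mulmx_sandwich_eq0 {m n} (M : 'M[C]_(m, n)) :
  (forall W, M *m W *m M = 0) -> M = 0.
Proof. by move=> M0; rewrite -(mulmx_mpinvK M). Qed.

Lemma sandwich_projections {m n} (X : 'M[C]_(n, m)) (P : 'M[C]_m) (Q : 'M[C]_n) :
  P *m P = P -> Q *m Q = Q ->
  (forall W, X *m W *m X = X *m P *m W *m (Q *m X)) ->
  X *m P = X /\ Q *m X = X.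
Proof.
move=> PP QQ XWX; split; apply/esym/eqP; rewrite -subr_eq0; apply/eqP.
  (* As [P] is idempotent, [W] and [P *m W] give the same right-hand side in [XWX]. *)
  have MX0 W : (X - X *m P) *m W *m X = 0.
    rewrite !mulmxBl -(mulmxA X P) !XWX !mulmxA -(mulmxA X P P) PP.
    by rewrite subrr.
  by apply: mulmx_sandwich_eq0 => W; rewrite mulmxBr mulmxA MX0 mul0mx subrr.
have XM0 W : X *m W *m (X - Q *m X) = 0.
  rewrite mulmxBr [X in _ - X]mulmxA -(mulmxA X W Q) !XWX !mulmxA.
  by rewrite -(mulmxA _ Q Q) QQ subrr.
apply: mulmx_sandwich_eq0 => W.
by rewrite !mulmxBl -!mulmxA !(mulmxA X) XM0 mulmx0 subrr.
Qed.

(** Moves every condition from [A] to [mpinv A], the only form in which [A] enters (b). *)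
Lemma diamond_le_mpinvP {m n} (A B : 'M[C]_(m, n)) :
  diamond_le A B <->
  [/\ mpinv A *m (B *m mpinv B) = mpinv A,
      mpinv B *m B *m mpinv A = mpinv A &
      mpinv A *m B *m mpinv A = mpinv A].
Proof.
have [P1 P2] := mpinv_mul_hermitian A _ (adjmx_mul_mpinv B).
have [Q1 Q2] := hermitian_mul_mpinv A _ (adjmx_mpinv_mul B).
split=> -[].
  by move=> /colspace_sub_mpinvP/P1 ? /colspace_adj_sub_mpinvP/Q1 ?
    /diamond_eq_mpinvP.
move=> /P2/colspace_sub_mpinvP ? /Q2/colspace_adj_sub_mpinvP ?.
by move=> /diamond_eq_mpinvP; split.
Qed.

Lemma diamond_le_sandwichP {m n} (A B : 'M[C]_(m, n)) :
  diamond_le A B <->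
  (forall W : 'M[C]_(m, n),
     mpinv A = mpinv A *m B *m mpinv A + mpinv A *m W *m mpinv A
               - mpinv A *m B *m mpinv B *m W *m mpinv B *m B *m mpinv A).
Proof.
rewrite diamond_le_mpinvP; split=> [[XP QX XBX] W|XE].
  (* Once [mpinv A] absorbs both projectors, the subtracted term is [mpinv A *m W *m mpinv A] and
     cancels. *)
  rewrite XBX -(mulmxA _ B (mpinv B)) XP.
  by rewrite -(mulmxA _ (mpinv B) B) -(mulmxA _ (mpinv B *m B)) QX addrK.
have XBX : mpinv A *m B *m mpinv A = mpinv A.
  by move/esym: (XE 0); rewrite !mulmx0 !mul0mx subr0 addr0.
have [||W|] := @sandwich_projections _ _ (mpinv A) (B *m mpinv B) (mpinv B *m B).
- by rewrite mulmxA mulmx_mpinvK.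
- by rewrite mulmxA mpinv_mulmxK.
- have := XE W; rewrite XBX -addrA -{1}[mpinv A]addr0 => /addrI/esym/eqP.
  by rewrite subr_eq0 !mulmxA => /eqP.
by split.
Qed.

End Diamond.

Theorem theorem2p3 (R : realType) (m n : nat) (A B : 'M[R[i]]_(m, n)) :
  diamond_le A B <->
  (forall W : 'M[R[i]]_(m, n),
     mpinv A = mpinv A *m B *m mpinv A + mpinv A *m W *m mpinv A
               - mpinv A *m B *m mpinv B *m W *m mpinv B *m B *m mpinv A).
Proof. exact: diamond_le_sandwichP. Qed.
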